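(* Let $\mathcal{C}$ be a protomodular category with finite limits and an initial object $0$. Then $\mathcal{C}$ is algebraically coherent if and only if for every object $X$ of $\mathcal{C}$ the change-of-base functor $\mathsf{Pt}_X(\mathcal{C})\to\mathsf{Pt}_0(\mathcal{C})$ along the unique morphism $0\to X$ is coherent. In particular, a pointed protomodular category $\mathcal{C}$ with finite limits is algebraically coherent if and only if for every object $X$ of $\mathcal{C}$ the kernel functor $\mathrm{Ker}\colon\mathsf{Pt}_X(\mathcal{C})\to\mathcal{C}$ is coherent.
   Context: $\mathsf{Pt}_X(\mathcal{C})$ is the category of points over $X$: objects are triples $(A,\ p\colon A\to X,\ s\colon X\to A)$ with $ps=1_X$, and morphisms are morphisms between the objects $A$ commuting with the $p$'s and the $s$'s. For $f\colon X\to Y$, the change-of-base functor $f^*\colon \mathsf{Pt}_Y(\mathcal{C})\to\mathsf{Pt}_X(\mathcal{C})$ is pulling back along $f$. A category is protomodular if it has pullbacks of split epimorphisms along any map and for every morphism $f$ the functor $f^*$ between categories of points reflects isomorphisms. When $\mathcal{C}$ is pointed, $\mathrm{Ker}\colon\mathsf{Pt}_X(\mathcal{C})\to\mathcal{C}$ sends $(A,p,s)$ to the kernel of $p$. A cospan $(f\colon X\to Z,\ g\colon Y\to Z)$ in a category with finite limits is jointly strongly epimorphic if every monomorphism into $Z$ through which both $f$ and $g$ factor is an isomorphism. A functor between categories with finite limits is coherent if it preserves finite limits and jointly strongly epimorphic pairs. A category $\mathcal{C}$ with finite limits is algebraically coherent if $f^*$ is coherent for every morphism $f$ of $\mathcal{C}$.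 *)

(* Defs.v *)
From Stdlib Require Import List ClassicalEpsilon.

Set Implicit Arguments.
Unset Strict Implicit.
Unset Printing Implicit Defensive.

Declare Scope category_scope.
Open Scope category_scope.

Record category : Type := Category {
  obj :> Type;
  hom : obj -> obj -> Type;
  idm : forall X, hom X X;
  comp : forall X Y Z, hom Y Z -> hom X Y -> hom X Z;
  comp_idl : forall X Y (f : hom X Y), comp (idm Y) f = f;
  comp_idr : forall X Y (f : hom X Y), comp f (idm X) = f;
  comp_assoc : forall W X Y Z (h : hom Y Z) (g : hom X Y) (f : hom W X),
    comp h (comp g f) = comp (comp h g) f
}.
Arguments hom {c} _ _.
Arguments idm {c} _.
Arguments comp {c X Y Z} _ _.

Notation "g ∘ f" := (comp g f) (at level 40, left associativity)
  : category_scope.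

Record functor (C D : category) : Type := Functor {
  fobj :> C -> D;
  fmap : forall X Y : C, hom X Y -> hom (fobj X) (fobj Y);
  fmap_id : forall X : C, fmap (idm X) = idm (fobj X);
  fmap_comp : forall (X Y Z : C) (g : hom Y Z) (f : hom X Y),
    fmap (g ∘ f) = fmap g ∘ fmap f
}.
Arguments fmap {C D} _ {X Y} _.

Lemma functor_comp_id (C D E : category) (G : functor D E) (F : functor C D)
  (X : C) : fmap G (fmap F (idm X)) = idm (G (F X)).
Proof. now rewrite !fmap_id. Qed.

Lemma functor_comp_comp (C D E : category) (G : functor D E) (F : functor C D)
  (X Y Z : C) (g : hom Y Z) (f : hom X Y) :
  fmap G (fmap F (g ∘ f)) = fmap G (fmap F g) ∘ fmap G (fmap F f).
Proof. now rewrite !fmap_comp. Qed.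

Definition functor_comp (C D E : category) (G : functor D E) (F : functor C D)
  : functor C E :=
  {| fobj := fun X => G (F X);
     fmap := fun X Y f => fmap G (fmap F f);
     fmap_id := functor_comp_id G F;
     fmap_comp := functor_comp_comp G F |}.

Definition is_iso (C : category) (X Y : C) (f : hom X Y) : Prop :=
  exists g : hom Y X, g ∘ f = idm X /\ f ∘ g = idm Y.

Definition is_mono (C : category) (X Y : C) (f : hom X Y) : Prop :=
  forall (W : C) (u v : hom W X), f ∘ u = f ∘ v -> u = v.

Definition reflects_isos (C D : category) (F : functor C D) : Prop :=
  forall (X Y : C) (f : hom X Y), is_iso (fmap F f) -> is_iso f.

Definition finite_type (T : Type) : Prop := exists l : list T, forall x, In x l.

Definition finite_category (J : category) : Prop :=
  finite_type J /\ forall i j : J, finite_type (hom i j).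

Record cone (J C : category) (D : functor J C) : Type := Cone {
  apex : C;
  leg : forall j : J, hom apex (D j);
  leg_nat : forall (i j : J) (a : hom i j), fmap D a ∘ leg i = leg j
}.
Arguments leg {J C D} _ _.

Definition is_limit (J C : category) (D : functor J C) (c : cone D) : Prop :=
  forall c' : cone D,
    exists! h : hom (apex c') (apex c), forall j : J, leg c j ∘ h = leg c' j.

Definition has_finite_limits (C : category) : Prop :=
  forall J : category, finite_category J ->
  forall D : functor J C, exists c : cone D, is_limit c.

Lemma map_cone_nat (J C D : category) (F : functor C D) (G : functor J C)
  (c : cone G) (i j : J) (a : hom i j) :
  fmap (functor_comp F G) a ∘ fmap F (leg c i) = fmap F (leg c j).
Proof. cbn. now rewrite <- fmap_comp, leg_nat. Qed.

Definition map_cone (J C D : category) (F : functor C D) (G : functor J C)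
  (c : cone G) : cone (functor_comp F G) :=
  {| apex := F (apex c);
     leg := (fun j => fmap F (leg c j))
       : forall j, hom (F (apex c)) (functor_comp F G j);
     leg_nat := map_cone_nat F c |}.

Definition preserves_finite_limits (C D : category) (F : functor C D) : Prop :=
  forall J : category, finite_category J ->
  forall (G : functor J C) (c : cone G), is_limit c -> is_limit (map_cone F c).

Definition jointly_strongly_epic (C : category) (X Y Z : C)
  (f : hom X Z) (g : hom Y Z) : Prop :=
  forall (M : C) (m : hom M Z), is_mono m ->
    (exists f' : hom X M, m ∘ f' = f) ->
    (exists g' : hom Y M, m ∘ g' = g) ->
    is_iso m.

Definition preserves_jointly_strongly_epic (C D : category) (F : functor C D)
  : Prop :=
  forall (X Y Z : C) (f : hom X Z) (g : hom Y Z),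
    jointly_strongly_epic f g ->
    jointly_strongly_epic (fmap F f) (fmap F g).

(* Used only for functors between categories with finite limits: if C has
   finite limits, so does every Pt X. *)
Definition coherent (C D : category) (F : functor C D) : Prop :=
  preserves_finite_limits F /\ preserves_jointly_strongly_epic F.

Definition is_initial (C : category) (O : C) : Prop :=
  forall X : C, exists! f : hom O X, True.

Definition is_terminal (C : category) (T : C) : Prop :=
  forall X : C, exists! f : hom X T, True.

Definition is_zero (C : category) (Z : C) : Prop :=
  is_initial Z /\ is_terminal Z.

Definition initial_arrow (C : category) (O : C) (HO : is_initial O) (X : C)
  : hom O X :=
  proj1_sig (constructive_definite_description _ (HO X)).

Definition terminal_arrow (C : category) (T : C) (HT : is_terminal T) (X : C)
  : hom X T :=
  proj1_sig (constructive_definite_description _ (HT X)).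

Definition zero_arrow (C : category) (Z : C) (HZ : is_zero Z) (X Y : C)
  : hom X Y :=
  initial_arrow (proj1 HZ) Y ∘ terminal_arrow (proj2 HZ) X.

Record point (C : category) (X : C) : Type := Point {
  pt_obj : C;
  pt_p : hom pt_obj X;
  pt_s : hom X pt_obj;
  pt_ps : pt_p ∘ pt_s = idm X
}.

Record point_hom (C : category) (X : C) (A B : point X) : Type := PointHom {
  ph_hom : hom (pt_obj A) (pt_obj B);
  ph_p : pt_p B ∘ ph_hom = pt_p A;
  ph_s : ph_hom ∘ pt_s A = pt_s B
}.

Lemma point_hom_eq (C : category) (X : C) (A B : point X)
  (h k : point_hom A B) : ph_hom h = ph_hom k -> h = k.
Proof.
destruct h as [h hp hs], k as [k kp ks]; cbn; intros E; subst k.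
now rewrite (proof_irrelevance _ kp hp), (proof_irrelevance _ ks hs).
Qed.

Definition point_id (C : category) (X : C) (A : point X) : point_hom A A :=
  {| ph_hom := idm (pt_obj A);
     ph_p := comp_idr (pt_p A);
     ph_s := comp_idl (pt_s A) |}.

Lemma point_comp_p (C : category) (X : C) (A B D : point X)
  (k : point_hom B D) (h : point_hom A B) :
  pt_p D ∘ (ph_hom k ∘ ph_hom h) = pt_p A.
Proof. now rewrite comp_assoc, !ph_p. Qed.

Lemma point_comp_s (C : category) (X : C) (A B D : point X)
  (k : point_hom B D) (h : point_hom A B) :
  (ph_hom k ∘ ph_hom h) ∘ pt_s A = pt_s D.
Proof. now rewrite <- comp_assoc, !ph_s. Qed.

Definition point_comp (C : category) (X : C) (A B D : point X)
  (k : point_hom B D) (h : point_hom A B) : point_hom A D :=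
  {| ph_hom := ph_hom k ∘ ph_hom h;
     ph_p := point_comp_p k h;
     ph_s := point_comp_s k h |}.

Lemma point_comp_idl (C : category) (X : C) (A B : point X)
  (h : point_hom A B) : point_comp (point_id B) h = h.
Proof. apply point_hom_eq, comp_idl. Qed.

Lemma point_comp_idr (C : category) (X : C) (A B : point X)
  (h : point_hom A B) : point_comp h (point_id A) = h.
Proof. apply point_hom_eq, comp_idr. Qed.

Lemma point_comp_assoc (C : category) (X : C) (A B D E : point X)
  (l : point_hom D E) (k : point_hom B D) (h : point_hom A B) :
  point_comp l (point_comp k h) = point_comp (point_comp l k) h.
Proof. apply point_hom_eq, comp_assoc. Qed.

Definition Pt (C : category) (X : C) : category :=
  {| obj := point X;
     hom := @point_hom C X;
     idm := @point_id C X;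
     comp := @point_comp C X;
     comp_idl := @point_comp_idl C X;
     comp_idr := @point_comp_idr C X;
     comp_assoc := @point_comp_assoc C X |}.

Record pullback (C : category) (X Y A : C) (f : hom X Y) (p : hom A Y)
  : Type := Pullback {
  pb_obj : C;
  pb_fst : hom pb_obj X;
  pb_snd : hom pb_obj A;
  pb_comm : f ∘ pb_fst = p ∘ pb_snd;
  pb_univ : forall (W : C) (u : hom W X) (v : hom W A), f ∘ u = p ∘ v ->
    exists! h : hom W pb_obj, pb_fst ∘ h = u /\ pb_snd ∘ h = v
}.

Definition pb_lift (C : category) (X Y A : C) (f : hom X Y) (p : hom A Y)
  (P : pullback f p) (W : C) (u : hom W X) (v : hom W A) (E : f ∘ u = p ∘ v)
  : hom W (pb_obj P) :=
  proj1_sig (constructive_definite_description _ (pb_univ P E)).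

Lemma pb_lift_fst (C : category) (X Y A : C) (f : hom X Y) (p : hom A Y)
  (P : pullback f p) (W : C) (u : hom W X) (v : hom W A) (E : f ∘ u = p ∘ v) :
  pb_fst P ∘ pb_lift P E = u.
Proof. unfold pb_lift; now destruct constructive_definite_description. Qed.

Lemma pb_lift_snd (C : category) (X Y A : C) (f : hom X Y) (p : hom A Y)
  (P : pullback f p) (W : C) (u : hom W X) (v : hom W A) (E : f ∘ u = p ∘ v) :
  pb_snd P ∘ pb_lift P E = v.
Proof. unfold pb_lift; now destruct constructive_definite_description. Qed.

Lemma pb_hom_eq (C : category) (X Y A : C) (f : hom X Y) (p : hom A Y)
  (P : pullback f p) (W : C) (h k : hom W (pb_obj P)) :
  pb_fst P ∘ h = pb_fst P ∘ k -> pb_snd P ∘ h = pb_snd P ∘ k -> h = k.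
Proof.
intros E1 E2.
assert (E : f ∘ (pb_fst P ∘ k) = p ∘ (pb_snd P ∘ k))
  by now rewrite !comp_assoc, pb_comm.
destruct (pb_univ P E) as [l [_ U]].
rewrite <- (U h (conj E1 E2)); exact (U k (conj eq_refl eq_refl)).
Qed.

Definition has_split_pullbacks (C : category) : Prop :=
  forall (X Y : C) (f : hom X Y) (A : point Y), inhabited (pullback f (pt_p A)).

(* The pullback functors depend on a choice of pullbacks, made here by the
   description axiom; by proof irrelevance it does not depend on [H]. *)
Definition the_pullback (C : category) (H : has_split_pullbacks C)
  (X Y : C) (f : hom X Y) (A : point Y) : pullback f (pt_p A) :=
  proj1_sig (constructive_indefinite_description (fun _ => True)
    (let (P) := H X Y f A in ex_intro _ P I)).

Lemma base_section_comm (C : category) (X Y : C) (f : hom X Y) (A : point Y) :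
  f ∘ idm X = pt_p A ∘ (pt_s A ∘ f).
Proof. now rewrite comp_assoc, pt_ps, comp_idl, comp_idr. Qed.

Definition base_obj (C : category) (H : has_split_pullbacks C)
  (X Y : C) (f : hom X Y) (A : point Y) : point X :=
  let P := the_pullback H f A in
  {| pt_obj := pb_obj P;
     pt_p := pb_fst P;
     pt_s := pb_lift P (base_section_comm f A);
     pt_ps := pb_lift_fst P (base_section_comm f A) |}.

Lemma base_hom_comm (C : category) (H : has_split_pullbacks C)
  (X Y : C) (f : hom X Y) (A B : point Y) (h : point_hom A B) :
  f ∘ pb_fst (the_pullback H f A)
  = pt_p B ∘ (ph_hom h ∘ pb_snd (the_pullback H f A)).
Proof. now rewrite comp_assoc, ph_p, pb_comm. Qed.

Lemma base_hom_s (C : category) (H : has_split_pullbacks C)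
  (X Y : C) (f : hom X Y) (A B : point Y) (h : point_hom A B) :
  pb_lift (the_pullback H f B) (base_hom_comm H f h) ∘ pt_s (base_obj H f A)
  = pt_s (base_obj H f B).
Proof.
apply pb_hom_eq; cbn; rewrite comp_assoc.
- now rewrite !pb_lift_fst.
- now rewrite !pb_lift_snd, <- comp_assoc, pb_lift_snd, comp_assoc, ph_s.
Qed.

Definition base_hom (C : category) (H : has_split_pullbacks C)
  (X Y : C) (f : hom X Y) (A B : point Y) (h : point_hom A B)
  : point_hom (base_obj H f A) (base_obj H f B) :=
  {| ph_hom := pb_lift (the_pullback H f B) (base_hom_comm H f h)
       : hom (pt_obj (base_obj H f A)) (pt_obj (base_obj H f B));
     ph_p := pb_lift_fst (the_pullback H f B) (base_hom_comm H f h);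
     ph_s := base_hom_s H f h |}.

Lemma base_hom_id (C : category) (H : has_split_pullbacks C)
  (X Y : C) (f : hom X Y) (A : Pt Y) :
  base_hom H f (idm A) = idm (base_obj H f A : Pt X).
Proof.
apply point_hom_eq, pb_hom_eq; cbn.
- now rewrite pb_lift_fst, comp_idr.
- now rewrite pb_lift_snd, comp_idl, comp_idr.
Qed.

Lemma base_hom_comp (C : category) (H : has_split_pullbacks C)
  (X Y : C) (f : hom X Y) (A B D : Pt Y) (k : hom B D) (h : hom A B) :
  base_hom H f (k ∘ h)
  = (base_hom H f k : @hom (Pt X) (base_obj H f B) (base_obj H f D))
    ∘ base_hom H f h.
Proof.
apply point_hom_eq, pb_hom_eq; cbn; rewrite comp_assoc.
- now rewrite !pb_lift_fst.
- now rewrite !pb_lift_snd, <- !comp_assoc, pb_lift_snd.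
Qed.

Definition change_of_base (C : category) (H : has_split_pullbacks C)
  (X Y : C) (f : hom X Y) : functor (Pt Y) (Pt X) :=
  {| fobj := (base_obj H f) : Pt Y -> Pt X;
     fmap := @base_hom C H X Y f;
     fmap_id := @base_hom_id C H X Y f;
     fmap_comp := @base_hom_comp C H X Y f |}.

Definition protomodular (C : category) : Prop :=
  exists H : has_split_pullbacks C,
    forall (X Y : C) (f : hom X Y), reflects_isos (change_of_base H f).

Inductive cospan_obj : Set := cs_left | cs_right | cs_base.

Definition cospan_hom (i j : cospan_obj) : Set :=
  match i, j with
  | cs_left, cs_left | cs_right, cs_right | _, cs_base => unit
  | _, _ => Empty_set
  end.

Definition cospan_id (i : cospan_obj) : cospan_hom i i :=
  match i with cs_left => tt | cs_right => tt | cs_base => tt end.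

Definition cospan_comp (i j k : cospan_obj) :
  cospan_hom j k -> cospan_hom i j -> cospan_hom i k.
Proof. destruct i, j, k; cbn; intros b a; solve [exact tt | destruct a | destruct b]. Defined.

Lemma cospan_hom_eq (i j : cospan_obj) (a b : cospan_hom i j) : a = b.
Proof. now destruct i, j, a, b. Qed.

Definition cospan : category :=
  {| obj := cospan_obj;
     hom := cospan_hom;
     idm := cospan_id;
     comp := cospan_comp;
     comp_idl := fun _ _ _ => cospan_hom_eq _ _;
     comp_idr := fun _ _ _ => cospan_hom_eq _ _;
     comp_assoc := fun _ _ _ _ _ _ _ => cospan_hom_eq _ _ |}.

Lemma cospan_finite : finite_category cospan.
Proof.
split.
- exists (cs_left :: cs_right :: cs_base :: nil); intros []; cbn; tauto.
- intros [] []; cbn;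
    first [ exists (tt :: nil); intros []; cbn; tauto
          | exists nil; intros [] ].
Qed.

Definition cospan_diagram_obj (C : category) (X Y A : C) (i : cospan) : C :=
  match i with cs_left => X | cs_right => A | cs_base => Y end.

Definition cospan_diagram_hom (C : category) (X Y A : C)
  (f : hom X Y) (p : hom A Y) (i j : cospan) :
  hom i j -> hom (cospan_diagram_obj X Y A i) (cospan_diagram_obj X Y A j) :=
  match i, j with
  | cs_left, cs_left => fun _ => idm X
  | cs_right, cs_right => fun _ => idm A
  | cs_base, cs_base => fun _ => idm Y
  | cs_left, cs_base => fun _ => f
  | cs_right, cs_base => fun _ => p
  | cs_left, cs_right => fun a => match a with end
  | cs_right, cs_left => fun a => match a with end
  | cs_base, cs_left => fun a => match a with end
  | cs_base, cs_right => fun a => match a with end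
  end.

Lemma cospan_diagram_id (C : category) (X Y A : C)
  (f : hom X Y) (p : hom A Y) (i : cospan) :
  cospan_diagram_hom f p (idm i) = idm (cospan_diagram_obj X Y A i).
Proof. now destruct i. Qed.

Lemma cospan_diagram_comp (C : category) (X Y A : C)
  (f : hom X Y) (p : hom A Y) (i j k : cospan) (b : hom j k) (a : hom i j) :
  cospan_diagram_hom f p (b ∘ a)
  = cospan_diagram_hom f p b ∘ cospan_diagram_hom f p a.
Proof.
destruct i, j, k; cbn in *; try destruct a; try destruct b; cbn;
  now rewrite ?comp_idl, ?comp_idr.
Qed.

Definition cospan_diagram (C : category) (X Y A : C)
  (f : hom X Y) (p : hom A Y) : functor cospan C :=
  {| fobj := @cospan_diagram_obj C X Y A;
     fmap := @cospan_diagram_hom C X Y A f p;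
     fmap_id := cospan_diagram_id f p;
     fmap_comp := @cospan_diagram_comp C X Y A f p |}.

Definition cospan_cone_leg (C : category) (X Y A : C)
  (f : hom X Y) (p : hom A Y) (W : C) (u : hom W X) (v : hom W A) (j : cospan)
  : hom W (cospan_diagram f p j) :=
  match j with cs_left => u | cs_right => v | cs_base => f ∘ u end.

Lemma cospan_cone_nat (C : category) (X Y A : C)
  (f : hom X Y) (p : hom A Y) (W : C) (u : hom W X) (v : hom W A)
  (E : f ∘ u = p ∘ v) (i j : cospan) (a : hom i j) :
  fmap (cospan_diagram f p) a ∘ cospan_cone_leg f p u v i
  = cospan_cone_leg f p u v j.
Proof.
destruct i, j; cbn in *; try destruct a; now rewrite ?comp_idl.
Qed.

Lemma has_pullbacks (C : category) (HL : has_finite_limits C)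
  (X Y A : C) (f : hom X Y) (p : hom A Y) : inhabited (pullback f p).
Proof.
destruct (HL cospan cospan_finite (cospan_diagram f p)) as [c Hc].
assert (El : f ∘ leg c cs_left = leg c cs_base)
  by exact (@leg_nat _ _ _ c cs_left cs_base tt).
assert (Er : p ∘ leg c cs_right = leg c cs_base)
  by exact (@leg_nat _ _ _ c cs_right cs_base tt).
constructor.
apply (@Pullback C X Y A f p (apex c) (leg c cs_left) (leg c cs_right)).
- now rewrite El, Er.
- intros W u v E.
  destruct (Hc (Cone (cospan_cone_nat E))) as [h [Hh Uh]].
  exists h; split.
  + split; [exact (Hh cs_left) | exact (Hh cs_right)].
  + intros k [Eu Ev]; apply Uh; intros []; cbn; trivial.
    rewrite <- El, <- comp_assoc. now f_equal.
Qed.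

Lemma finite_limits_split_pullbacks (C : category) (HL : has_finite_limits C) :
  has_split_pullbacks C.
Proof. intros X Y f A; exact (has_pullbacks HL f (pt_p A)). Qed.

Definition algebraically_coherent (C : category) (HL : has_finite_limits C)
  : Prop :=
  forall (X Y : C) (f : hom X Y),
    coherent (change_of_base (finite_limits_split_pullbacks HL) f).

Record kernel (C : category) (Z : C) (HZ : is_zero Z) (A X : C) (p : hom A X)
  : Type := Kernel {
  ker_obj : C;
  ker_hom : hom ker_obj A;
  ker_zero : p ∘ ker_hom = zero_arrow HZ ker_obj X;
  ker_univ : forall (W : C) (u : hom W A), p ∘ u = zero_arrow HZ W X ->
    exists! h : hom W ker_obj, ker_hom ∘ h = u
}.

Lemma initial_arrow_unique (C : category) (O : C) (HO : is_initial O) (X : C)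
  (f g : hom O X) : f = g.
Proof. destruct (HO X) as [h [_ U]]. now rewrite <- (U f I), <- (U g I). Qed.

Lemma terminal_arrow_unique (C : category) (T : C) (HT : is_terminal T) (X : C)
  (f g : hom X T) : f = g.
Proof. destruct (HT X) as [h [_ U]]. now rewrite <- (U f I), <- (U g I). Qed.

Lemma zero_arrow_comp (C : category) (Z : C) (HZ : is_zero Z) (W X Y : C)
  (f : hom W X) : zero_arrow HZ X Y ∘ f = zero_arrow HZ W Y.
Proof.
unfold zero_arrow; rewrite <- comp_assoc; f_equal.
apply (terminal_arrow_unique (proj2 HZ)).
Qed.

Lemma has_kernels (C : category) (HL : has_finite_limits C)
  (Z : C) (HZ : is_zero Z) (A X : C) (p : hom A X) : inhabited (kernel HZ p).
Proof.
destruct (has_pullbacks HL (initial_arrow (proj1 HZ) X) p) as [P].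
constructor.
apply (@Kernel C Z HZ A X p (pb_obj P) (pb_snd P)).
- rewrite <- pb_comm; unfold zero_arrow; f_equal.
  apply (terminal_arrow_unique (proj2 HZ)).
- intros W u E; symmetry in E.
  destruct (pb_univ P E) as [h [[_ Hh] U]].
  exists h; split; trivial.
  intros k Hk; apply U; split; trivial.
  apply (terminal_arrow_unique (proj2 HZ)).
Qed.

Definition the_kernel (C : category) (HL : has_finite_limits C)
  (Z : C) (HZ : is_zero Z) (A X : C) (p : hom A X) : kernel HZ p :=
  proj1_sig (constructive_indefinite_description (fun _ => True)
    (let (K) := has_kernels HL HZ p in ex_intro _ K I)).

Definition ker_lift (C : category) (Z : C) (HZ : is_zero Z) (A X : C)
  (p : hom A X) (K : kernel HZ p) (W : C) (u : hom W A)
  (E : p ∘ u = zero_arrow HZ W X) : hom W (ker_obj K) :=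
  proj1_sig (constructive_definite_description _ (ker_univ K E)).

Lemma ker_liftK (C : category) (Z : C) (HZ : is_zero Z) (A X : C)
  (p : hom A X) (K : kernel HZ p) (W : C) (u : hom W A)
  (E : p ∘ u = zero_arrow HZ W X) : ker_hom K ∘ ker_lift K E = u.
Proof. unfold ker_lift; now destruct constructive_definite_description. Qed.

Lemma ker_hom_eq (C : category) (Z : C) (HZ : is_zero Z) (A X : C)
  (p : hom A X) (K : kernel HZ p) (W : C) (h k : hom W (ker_obj K)) :
  ker_hom K ∘ h = ker_hom K ∘ k -> h = k.
Proof.
intros E.
assert (E0 : p ∘ (ker_hom K ∘ k) = zero_arrow HZ W X)
  by now rewrite comp_assoc, ker_zero, zero_arrow_comp.
destruct (ker_univ K E0) as [l [_ U]].
now rewrite <- (U h E), <- (U k eq_refl).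
Qed.

Lemma Ker_hom_zero (C : category) (HL : has_finite_limits C)
  (Z : C) (HZ : is_zero Z) (X : C) (A B : point X) (h : point_hom A B) :
  let K := the_kernel HL HZ (pt_p A) in
  pt_p B ∘ (ph_hom h ∘ ker_hom K) = zero_arrow HZ (ker_obj K) X.
Proof. cbn; now rewrite comp_assoc, ph_p, ker_zero. Qed.

Definition Ker_obj (C : category) (HL : has_finite_limits C)
  (Z : C) (HZ : is_zero Z) (X : C) (A : Pt X) : C :=
  ker_obj (the_kernel HL HZ (pt_p A)).

Definition Ker_hom (C : category) (HL : has_finite_limits C)
  (Z : C) (HZ : is_zero Z) (X : C) (A B : Pt X) (h : hom A B)
  : hom (Ker_obj HL HZ A) (Ker_obj HL HZ B) :=
  ker_lift (the_kernel HL HZ (pt_p B)) (Ker_hom_zero HL HZ h).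

Lemma Ker_id (C : category) (HL : has_finite_limits C)
  (Z : C) (HZ : is_zero Z) (X : C) (A : Pt X) :
  Ker_hom HL HZ (idm A) = idm (Ker_obj HL HZ A).
Proof.
apply ker_hom_eq; unfold Ker_hom; rewrite ker_liftK; cbn.
now rewrite comp_idl, comp_idr.
Qed.

Lemma Ker_comp (C : category) (HL : has_finite_limits C)
  (Z : C) (HZ : is_zero Z) (X : C) (A B D : Pt X) (k : hom B D) (h : hom A B) :
  Ker_hom HL HZ (k ∘ h) = Ker_hom HL HZ k ∘ Ker_hom HL HZ h.
Proof.
apply ker_hom_eq; unfold Ker_hom, Ker_obj.
rewrite comp_assoc, !ker_liftK, <- comp_assoc, ker_liftK; cbn.
now rewrite comp_assoc.
Qed.

Definition Ker (C : category) (HL : has_finite_limits C)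
  (Z : C) (HZ : is_zero Z) (X : C) : functor (Pt X) C :=
  {| fobj := @Ker_obj C HL Z HZ X;
     fmap := @Ker_hom C HL Z HZ X;
     fmap_id := @Ker_id C HL Z HZ X;
     fmap_comp := @Ker_comp C HL Z HZ X |}.

(* Main.v *)
Require Import Defs.
From Stdlib Require Import List ClassicalEpsilon.

Set Implicit Arguments.
Unset Strict Implicit.
Unset Printing Implicit Defensive.

(** Every change-of-base functor preserves finite limits
    ([change_of_base_limits]), so that coherence only concerns jointly strongly
    epimorphic pairs.  Let [f : X -> Y] and let [i_X], [i_Y] be the arrows from
    the initial object.  Since [f ∘ i_X = i_Y], pasting of pullbacks gives a
    natural isomorphism between the functor [i_Y^*] and the composite of [f^*]
    followed by [i_X^*] ([change_of_base_comp]).  The composite preserves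
    jointly strongly epimorphic pairs when [i_Y^*] does, while [i_X^*] reflects
    isomorphisms by protomodularity and preserves monomorphisms.  These
    properties of [i_X^*] let one test on its images whether a monomorphism
    through which a pair factors is invertible, so [f^*] preserves such pairs
    too ([preserves_jse_of_comp]).

    When the initial object is a zero object [Z], points over [Z] amount to
    objects of the category: the forgetful functor [Pt Z -> C] and the functor
    [trivial_point] in the other direction are equivalences, hence coherent
    ([equivalence_coherent]).  They transform the functors [i_X^*] and [Ker]
    into each other up to natural isomorphism, so one is coherent exactly when
    the other is. *)

(** * Isomorphic functors and composites *)

(** The inverse components are part of the data so that symmetry needs no
    choice. *)
Definition nat_isomorphic (C D : category) (F G : functor C D) : Prop :=
  exists (phi : forall X, hom (F X) (G X)) (psi : forall X, hom (G X) (F X)),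
    (forall X, psi X ∘ phi X = idm (F X)) /\
    (forall X, phi X ∘ psi X = idm (G X)) /\
    forall (X Y : C) (h : hom X Y), phi Y ∘ fmap F h = fmap G h ∘ phi X.

Lemma inverse_natural (C D : category) (F G : functor C D)
  (phi : forall X, hom (F X) (G X)) (psi : forall X, hom (G X) (F X))
  (E1 : forall X, psi X ∘ phi X = idm (F X))
  (E2 : forall X, phi X ∘ psi X = idm (G X))
  (N : forall (X Y : C) (h : hom X Y), phi Y ∘ fmap F h = fmap G h ∘ phi X)
  (X Y : C) (h : hom X Y) : psi Y ∘ fmap G h = fmap F h ∘ psi X.
Proof.
rewrite <- (comp_idr (psi Y ∘ fmap G h)), <- (E2 X).
rewrite comp_assoc, <- (comp_assoc (psi Y)), <- N.
now rewrite (comp_assoc (psi Y)), E1, comp_idl.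
Qed.

Lemma nat_isomorphic_sym (C D : category) (F G : functor C D) :
  nat_isomorphic F G -> nat_isomorphic G F.
Proof.
intros (phi & psi & E1 & E2 & N); exists psi, phi.
split; [exact E2 | split; [exact E1 | exact (inverse_natural E1 E2 N)]].
Qed.

Lemma preserves_limits_iso (C D : category) (F G : functor C D) :
  nat_isomorphic F G -> preserves_finite_limits F -> preserves_finite_limits G.
Proof.
intros (phi & psi & E1 & E2 & N) HF J HJ K c Hc c'.
pose proof (inverse_natural E1 E2 N) as N'.
assert (Nat : forall (i j : J) (a : hom i j),
  fmap (functor_comp F K) a ∘ (psi (K i) ∘ leg c' i) = psi (K j) ∘ leg c' j).
{ intros i j a; cbn.
  rewrite comp_assoc, <- N', <- comp_assoc; f_equal.
  exact (leg_nat c' a). }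
destruct (HF J HJ K c Hc
  (@Cone J D (functor_comp F K) (apex c') (fun j => psi (K j) ∘ leg c' j) Nat))
  as [h [Hh Uh]].
cbn in h, Hh, Uh.
exists (phi (apex c) ∘ h); split; cbn.
- intros j.
  rewrite comp_assoc, <- N, <- comp_assoc, Hh.
  now rewrite comp_assoc, E2, comp_idl.
- intros k Hk.
  rewrite (Uh (psi (apex c) ∘ k)).
  + now rewrite comp_assoc, E2, comp_idl.
  + intros j; cbn.
    now rewrite comp_assoc, <- N', <- comp_assoc, Hk.
Qed.

Lemma preserves_jse_iso (C D : category) (F G : functor C D) :
  nat_isomorphic F G -> preserves_jointly_strongly_epic F ->
  preserves_jointly_strongly_epic G.
Proof.
intros (phi & psi & E1 & E2 & N) HF X Y Z f g Hfg M m Hm [f' Ef] [g' Eg].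
assert (Hi : is_iso (psi Z ∘ m)).
{ apply (HF X Y Z f g Hfg).
  - intros W u v E; apply Hm.
    rewrite <- (comp_idl (m ∘ u)), <- (comp_idl (m ∘ v)), <- (E2 Z).
    rewrite <- !(comp_assoc (phi Z)); f_equal.
    now rewrite !comp_assoc.
  - exists (f' ∘ phi X).
    rewrite comp_assoc, <- (comp_assoc (psi Z)), Ef, <- comp_assoc, <- N.
    now rewrite comp_assoc, E1, comp_idl.
  - exists (g' ∘ phi Y).
    rewrite comp_assoc, <- (comp_assoc (psi Z)), Eg, <- comp_assoc, <- N.
    now rewrite comp_assoc, E1, comp_idl. }
destruct Hi as [n [En1 En2]].
exists (n ∘ psi Z); split.
- now rewrite <- comp_assoc.
- apply (f_equal (fun k => phi Z ∘ k ∘ psi Z)) in En2.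
  rewrite comp_idr, E2 in En2.
  rewrite <- En2, !comp_assoc, E2, comp_idl. reflexivity.
Qed.

Lemma coherent_iso (C D : category) (F G : functor C D) :
  nat_isomorphic F G -> coherent F -> coherent G.
Proof.
intros I [HL HJ]; split.
- exact (preserves_limits_iso I HL).
- exact (preserves_jse_iso I HJ).
Qed.

Lemma coherent_comp (C D E : category) (G : functor D E) (F : functor C D) :
  coherent G -> coherent F -> coherent (functor_comp G F).
Proof.
intros [GL GJ] [FL FJ]; split.
- intros J HJ K c Hc c'.
  (* The two bracketings of the composite diagram have the same values. *)
  exact (GL J HJ _ _ (FL J HJ K c Hc)
    (@Cone J E (functor_comp G (functor_comp F K)) (apex c')
       (leg c') (fun i j a => leg_nat c' a))).
- intros X Y Z f g H; exact (GJ _ _ _ _ _ (FJ _ _ _ _ _ H)).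
Qed.

(** A morphism [m] is a monomorphism exactly when the identities form a
    pullback of [m] along itself, and this is a finite limit. *)
Lemma preserves_mono (C D : category) (F : functor C D)
  (HF : preserves_finite_limits F) (X Y : C) (m : hom X Y) :
  is_mono m -> is_mono (fmap F m).
Proof.
intros Hm W u v E.
pose (c := Cone (cospan_cone_nat (f := m) (p := m) (u := idm X) (v := idm X)
                   eq_refl)).
assert (Hc : is_limit c).
{ intros c'.
  assert (El : m ∘ leg c' cs_left = leg c' cs_base)
    by exact (@leg_nat _ _ _ c' cs_left cs_base tt).
  assert (Er : m ∘ leg c' cs_right = leg c' cs_base)
    by exact (@leg_nat _ _ _ c' cs_right cs_base tt).
  exists (leg c' cs_left); split.
  - intros []; cbn; rewrite ?comp_idl, ?comp_idr; trivial.
    apply Hm. exact (eq_trans El (eq_sym Er)).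
  - intros k Hk; specialize (Hk cs_left); cbn in Hk.
    now rewrite comp_idl in Hk. }
assert (Nat : forall (i j : cospan) (a : hom i j),
  fmap (functor_comp F (cospan_diagram m m)) a
    ∘ (match i with
       | cs_left => u | cs_right => v | cs_base => fmap F m ∘ u end
       : hom W (functor_comp F (cospan_diagram m m) i))
  = match j with
    | cs_left => u | cs_right => v | cs_base => fmap F m ∘ u end).
{ intros [] [] a; cbn in *; try destruct a; rewrite ?fmap_id, ?comp_idl; easy. }
destruct (HF cospan cospan_finite (cospan_diagram m m) c Hc (Cone Nat))
  as [h [Hh _]].
assert (Eu := Hh cs_left); assert (Ev := Hh cs_right); cbn in Eu, Ev.
now rewrite <- Eu, <- Ev.
Qed.

(** Whether a monomorphism is invertible can be tested after applying [G], and
    [G] sends the monomorphisms relevant to the pair [F f, F g] to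
    monomorphisms relevant to its image. *)
Lemma preserves_jse_of_comp (C D E : category) (G : functor D E)
  (F : functor C D) :
  preserves_finite_limits G -> reflects_isos G ->
  preserves_jointly_strongly_epic (functor_comp G F) ->
  preserves_jointly_strongly_epic F.
Proof.
intros GL GR GF X Y Z f g Hfg M m Hm [f' Ef] [g' Eg].
apply GR, (GF _ _ _ _ _ Hfg).
- exact (preserves_mono GL Hm).
- exists (fmap G f'); cbn; now rewrite <- fmap_comp, Ef.
- exists (fmap G g'); cbn; now rewrite <- fmap_comp, Eg.
Qed.

(** * Equivalences of categories *)

Definition fully_faithful (C D : category) (F : functor C D) : Prop :=
  forall (X Y : C) (k : hom (F X) (F Y)), exists! h : hom X Y, fmap F h = k.

Definition essentially_surjective (C D : category) (F : functor C D) : Prop :=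
  forall W : D, exists (X : C) (i : hom (F X) W), is_iso i.

Lemma fully_faithful_inj (C D : category) (F : functor C D)
  (HF : fully_faithful F) (X Y : C) (h k : hom X Y) :
  fmap F h = fmap F k -> h = k.
Proof.
intros E; destruct (HF X Y (fmap F k)) as [l [_ U]].
now rewrite <- (U h E), <- (U k eq_refl).
Qed.

Lemma equivalence_limits (C D : category) (F : functor C D) :
  fully_faithful F -> essentially_surjective F -> preserves_finite_limits F.
Proof.
intros FF FE J HJ K c Hc c'.
destruct (FE (apex c')) as (A & i & n & E1 & E2).
pose (l := fun j => proj1_sig (constructive_definite_description _
  (FF A (K j) (leg c' j ∘ i)))).
assert (Hl : forall j, fmap F (l j) = leg c' j ∘ i).
{ intros j; unfold l; now destruct constructive_definite_description. }
assert (Nat : forall (j k : J) (a : hom j k), fmap K a ∘ l j = l k).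
{ intros j k a; apply (fully_faithful_inj FF).
  rewrite fmap_comp, !Hl, comp_assoc; f_equal.
  exact (leg_nat c' a). }
destruct (Hc (@Cone J C K A l Nat)) as [h [Hh Uh]]; cbn in h, Hh, Uh.
exists (fmap F h ∘ n); split.
- intros j; cbn.
  rewrite comp_assoc, <- fmap_comp, Hh, Hl, <- comp_assoc, E2.
  apply comp_idr.
- intros k Hk.
  destruct (FF A (apex c) (k ∘ i)) as [k' [Ek' _]].
  rewrite (Uh k').
  + now rewrite Ek', <- comp_assoc, E2, comp_idr.
  + intros j; apply (fully_faithful_inj FF).
    rewrite fmap_comp, Ek', Hl, comp_assoc; f_equal.
    exact (Hk j).
Qed.

Lemma equivalence_jse (C D : category) (F : functor C D) :
  fully_faithful F -> essentially_surjective F ->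
  preserves_jointly_strongly_epic F.
Proof.
intros FF FE X Y Z f g Hfg M m Hm [f' Ef] [g' Eg].
destruct (FE M) as (A & i & n & E1 & E2).
destruct (FF A Z (m ∘ i)) as [m' [Em' _]].
assert (Fac : forall (T : C) (t : hom T Z) (t' : hom (F T) M),
  m ∘ t' = fmap F t -> exists t0 : hom T A, m' ∘ t0 = t).
{ intros T t t' E.
  destruct (FF T A (n ∘ t')) as [t0 [E0 _]].
  exists t0; apply (fully_faithful_inj FF).
  rewrite fmap_comp, E0, Em', comp_assoc, <- (comp_assoc m), E2, comp_idr.
  exact E. }
assert (Hi : is_iso m').
{ apply (Hfg A m').
  - intros W u v E.
    apply (fully_faithful_inj FF).
    rewrite <- (comp_idl (fmap F u)), <- (comp_idl (fmap F v)), <- E1.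
    rewrite <- !comp_assoc; f_equal.
    apply Hm; rewrite !comp_assoc, <- Em', <- !fmap_comp; now f_equal.
  - exact (Fac X f f' Ef).
  - exact (Fac Y g g' Eg). }
destruct Hi as [r [Er1 Er2]].
exists (i ∘ fmap F r); split.
- apply Hm.
  now rewrite !comp_assoc, <- Em', <- fmap_comp, Er2, fmap_id, comp_idl,
    comp_idr.
- now rewrite comp_assoc, <- Em', <- fmap_comp, Er2, fmap_id.
Qed.

Lemma equivalence_coherent (C D : category) (F : functor C D) :
  fully_faithful F -> essentially_surjective F -> coherent F.
Proof.
intros FF FE; split;
  [exact (equivalence_limits FF FE) | exact (equivalence_jse FF FE)].
Qed.

(** * Change of base preserves finite limits *)

Section AddTerminal.
Variable J : category.

Definition top_hom (i j : option J) : Type :=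
  match i, j with
  | Some i, Some j => hom i j
  | _, None => unit
  | None, Some _ => Empty_set
  end.

Definition top_id (i : option J) : top_hom i i :=
  match i with Some i => idm i | None => tt end.

Definition top_comp (i j k : option J) :
  top_hom j k -> top_hom i j -> top_hom i k :=
  match i, j, k with
  | Some i, Some j, Some k => fun b a => b ∘ a
  | Some _, None, Some _ => fun b _ => match b with end
  | None, Some _, Some _ => fun _ a => match a with end
  | None, None, Some _ => fun b _ => b
  | Some _, _, None => fun _ _ => tt
  | None, _, None => fun _ _ => tt
  end.

Lemma top_idl (i j : option J) (a : top_hom i j) : top_comp (top_id j) a = a.
Proof.
destruct i, j; cbn in *; try destruct a; trivial; apply comp_idl.
Qed.

Lemma top_idr (i j : option J) (a : top_hom i j) : top_comp a (top_id i) = a.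
Proof.
destruct i, j; cbn in *; try destruct a; trivial; apply comp_idr.
Qed.

Lemma top_assoc (i j k l : option J) (c : top_hom k l) (b : top_hom j k)
  (a : top_hom i j) :
  top_comp c (top_comp b a) = top_comp (top_comp c b) a.
Proof.
destruct i, j, k, l; cbn in *; try destruct a; try destruct b; try destruct c;
  trivial; apply comp_assoc.
Qed.

Definition add_terminal : category :=
  {| obj := option J;
     hom := top_hom;
     idm := top_id;
     comp := top_comp;
     comp_idl := top_idl;
     comp_idr := top_idr;
     comp_assoc := top_assoc |}.

Lemma add_terminal_finite : finite_category J -> finite_category add_terminal.
Proof.
intros [[l Hl] HJ]; split.
- exists (None :: map Some l); intros [j |]; cbn; [right | now left].
  now apply in_map.
- assert (HU : finite_type unit)
    by (exists (tt :: nil); intros []; now left).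
  assert (HE : finite_type Empty_set) by (exists nil; intros []).
  intros [i |] [j |]; [exact (HJ i j) | exact HU | exact HE | exact HU].
Qed.

Variables (C : category) (Y : C) (K : functor J (Pt Y)).

Definition points_diagram_obj (i : add_terminal) : C :=
  match i with Some j => pt_obj (K j) | None => Y end.

Definition points_diagram_hom (i j : add_terminal) :
  hom i j -> hom (points_diagram_obj i) (points_diagram_obj j) :=
  match i, j with
  | Some i, Some j => fun a => ph_hom (fmap K a)
  | Some i, None => fun _ => pt_p (K i)
  | None, None => fun _ => idm Y
  | None, Some _ => fun a => match a with end
  end.

Lemma points_diagram_id (i : add_terminal) :
  points_diagram_hom (idm i) = idm (points_diagram_obj i).
Proof. destruct i; cbn; trivial. now rewrite fmap_id. Qed.

Lemma points_diagram_comp (i j k : add_terminal) (b : hom j k) (a : hom i j) :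
  points_diagram_hom (b ∘ a) = points_diagram_hom b ∘ points_diagram_hom a.
Proof.
destruct i, j, k; cbn in *; try destruct a; try destruct b;
  rewrite ?fmap_comp, ?comp_idl, ?ph_p; trivial.
Qed.

(** Adjoining the base object [Y] as a terminal vertex makes limits in [C] of
    this diagram agree with limits of [K] over [Y], even when [J] is empty or
    disconnected. *)
Definition points_diagram : functor add_terminal C :=
  {| fobj := points_diagram_obj;
     fmap := points_diagram_hom;
     fmap_id := points_diagram_id;
     fmap_comp := points_diagram_comp |}.

Definition points_cone_leg (W : C) (q : hom W Y)
  (w : forall j : J, hom W (pt_obj (K j))) (i : add_terminal)
  : hom W (points_diagram i) :=
  match i with Some j => w j | None => q end.

Lemma points_cone_nat (W : C) (q : hom W Y)
  (w : forall j : J, hom W (pt_obj (K j)))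
  (Hq : forall j, pt_p (K j) ∘ w j = q)
  (Hw : forall (i j : J) (a : hom i j), ph_hom (fmap K a) ∘ w i = w j)
  (i j : add_terminal) (a : hom i j) :
  fmap points_diagram a ∘ points_cone_leg q w i = points_cone_leg q w j.
Proof.
destruct i, j; cbn in *; try destruct a; rewrite ?comp_idl; trivial.
Qed.
End AddTerminal.

(** The universal property of a limit of points extends to cones whose apex is
    an object over [Y] without a section.  The limit [L] of the same diagram in
    [C] has this property; it carries a section by its universality, so it is
    also a limit in [Pt Y], and the two limits can be compared. *)
Lemma limit_of_points (C : category) (HL : has_finite_limits C) (Y : C)
  (J : category) (HJ : finite_category J) (K : functor J (Pt Y)) (c : cone K)
  (Hc : is_limit c) (W : C) (q : hom W Y)
  (w : forall j : J, hom W (pt_obj (K j)))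
  (Hq : forall j, pt_p (K j) ∘ w j = q)
  (Hw : forall (i j : J) (a : hom i j), ph_hom (fmap K a) ∘ w i = w j) :
  exists! h : hom W (pt_obj (apex c)),
    pt_p (apex c) ∘ h = q /\ forall j, ph_hom (leg c j) ∘ h = w j.
Proof.
destruct (HL _ (add_terminal_finite HJ) (points_diagram K)) as [L HLim].
assert (Lp : forall j, pt_p (K j) ∘ leg L (Some j) = leg L None).
{ intros j; exact (@leg_nat _ _ _ L (Some j) None tt). }
assert (Ln : forall (i j : J) (a : hom i j),
  ph_hom (fmap K a) ∘ leg L (Some i) = leg L (Some j)).
{ intros i j a; exact (@leg_nat _ _ _ L (Some i) (Some j) a). }
assert (univ : forall (V : C) (r : hom V Y)
  (v : forall j : J, hom V (pt_obj (K j))),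
  (forall j, pt_p (K j) ∘ v j = r) ->
  (forall (i j : J) (a : hom i j), ph_hom (fmap K a) ∘ v i = v j) ->
  exists! h : hom V (apex L),
    leg L None ∘ h = r /\ forall j, leg L (Some j) ∘ h = v j).
{ intros V r v Hr Hv.
  destruct (HLim (Cone (points_cone_nat Hr Hv))) as [h [Hh Uh]].
  exists h; split.
  - split; [exact (Hh None) | intros j; exact (Hh (Some j))].
  - intros k [Ek1 Ek2]; apply Uh; intros [j |]; [exact (Ek2 j) | exact Ek1]. }
(* The section of [L] is induced by the sections of the points [K j]. *)
destruct (univ Y (idm Y) (fun j => pt_s (K j)) (fun j => pt_ps (K j))
  (fun i j a => ph_s (fmap K a))) as [s [[Es1 Es2] _]].
pose (LP := @Point C Y (apex L) (leg L None) s Es1).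
pose (ll := fun j => (@PointHom C Y LP (K j) (leg L (Some j)) (Lp j) (Es2 j))
  : @hom (Pt Y) LP (K j)).
assert (lln : forall (i j : J) (a : hom i j), fmap K a ∘ ll i = ll j).
{ intros i j a; apply point_hom_eq, Ln. }
destruct (Hc (Cone lln)) as [kP [Hk _]].
pose (k := ph_hom kP : hom (apex L) (pt_obj (apex c))).
(* As [k ∘ l = 1], a morphism into the apex of [c] is determined by its
   composite with [l], to which uniqueness for [L] applies. *)
assert (Ek : forall j, ph_hom (leg c j) ∘ k = leg L (Some j)).
{ intros j; exact (f_equal (@ph_hom _ _ _ _) (Hk j)). }
assert (Cn : forall (i j : J) (a : hom i j),
  ph_hom (fmap K a) ∘ ph_hom (leg c i) = ph_hom (leg c j)).
{ intros i j a; exact (f_equal (@ph_hom _ _ _ _) (leg_nat c a)). }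
destruct (univ (pt_obj (apex c)) (pt_p (apex c)) (fun j => ph_hom (leg c j))
  (fun j => ph_p (leg c j)) Cn) as [l [[El1 El2] _]].
assert (Els : l ∘ pt_s (apex c) = s).
{ destruct (univ Y (idm Y) (fun j => pt_s (K j)) (fun j => pt_ps (K j))
    (fun i j a => ph_s (fmap K a))) as [t [_ Ut]].
  rewrite <- (Ut s (conj Es1 Es2)); symmetry; apply Ut; split.
  - rewrite comp_assoc, El1; apply pt_ps.
  - intros j; rewrite comp_assoc, El2; exact (ph_s (leg c j)). }
pose (lP := (@PointHom C Y (apex c) LP l El1 Els) : @hom (Pt Y) (apex c) LP).
assert (Ekl : k ∘ l = idm (pt_obj (apex c))).
{ destruct (Hc c) as [t [_ Ut]].
  assert (E : kP ∘ lP = idm (apex c)).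
  { rewrite <- (Ut (idm (apex c)) (fun j => comp_idr (leg c j))).
    symmetry; apply Ut; intros j.
    rewrite comp_assoc; transitivity (ll j ∘ lP).
    - f_equal; exact (Hk j).
    - apply point_hom_eq, El2. }
  exact (f_equal (@ph_hom _ _ _ _) E). }
destruct (univ W q w Hq Hw) as [h [[Eh1 Eh2] Uh]].
exists (k ∘ h); split.
- split.
  + rewrite comp_assoc, (ph_p kP : _ ∘ k = _); exact Eh1.
  + intros j; rewrite comp_assoc, Ek; exact (Eh2 j).
- intros h' [E1 E2].
  rewrite (Uh (l ∘ h')).
  + now rewrite comp_assoc, Ekl, comp_idl.
  + split; [now rewrite comp_assoc, El1 |].
    intros j; rewrite comp_assoc, El2; exact (E2 j).
Qed.

(** A morphism of points into [f^* A] is a morphism into [A] over [f] that is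
    compatible with the sections.  Its domain is an object over [Y], by
    composition with [f], but not a point over [Y], which is why
    [limit_of_points] is needed. *)
Lemma change_of_base_limits (C : category) (HL : has_finite_limits C)
  (H : has_split_pullbacks C) (X Y : C) (f : hom X Y) :
  preserves_finite_limits (change_of_base H f).
Proof.
intros J HJ K c Hc c'.
pose (B := apex c' : point X).
pose (P := fun A : point Y => the_pullback H f A).
pose (b := fun j => ph_hom (leg c' j) : hom (pt_obj B) (pb_obj (P (K j)))).
assert (Bp : forall j, pb_fst (P (K j)) ∘ b j = pt_p B)
  by (intros j; exact (ph_p (leg c' j))).
assert (Bs : forall j, b j ∘ pt_s B = pb_lift (P (K j)) (base_section_comm f (K j)))
  by (intros j; exact (ph_s (leg c' j))).
assert (Bn : forall (i j : J) (a : hom i j),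
  pb_lift (P (K j)) (base_hom_comm H f (fmap K a)) ∘ b i = b j)
  by (intros i j a; exact (f_equal (@ph_hom _ _ _ _) (leg_nat c' a))).
pose (w := fun j => pb_snd (P (K j)) ∘ b j).
assert (Hq : forall j, pt_p (K j) ∘ w j = f ∘ pt_p B).
{ intros j; unfold w.
  now rewrite comp_assoc, <- pb_comm, <- comp_assoc, Bp. }
assert (Hw : forall (i j : J) (a : hom i j), ph_hom (fmap K a) ∘ w i = w j).
{ intros i j a; unfold w.
  rewrite <- (Bn i j a), (comp_assoc (pb_snd _)), pb_lift_snd.
  now rewrite comp_assoc. }
destruct (limit_of_points HL HJ Hc Hq Hw) as [h [[Eh1 Eh2] Uh]].
(* Both sides are the morphism induced by the family [pt_s (K j) ∘ f]. *)
assert (Ehs : h ∘ pt_s B = pt_s (apex c) ∘ f).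
{ assert (Sq : forall j, pt_p (K j) ∘ (pt_s (K j) ∘ f) = f)
    by (intros j; now rewrite comp_assoc, pt_ps, comp_idl).
  assert (Sw : forall (i j : J) (a : hom i j),
    ph_hom (fmap K a) ∘ (pt_s (K i) ∘ f) = pt_s (K j) ∘ f)
    by (intros i j a; now rewrite comp_assoc, ph_s).
  destruct (limit_of_points HL HJ Hc Sq Sw) as [t [_ Ut]].
  rewrite <- (Ut (h ∘ pt_s B)); [apply Ut |]; split.
  - now rewrite comp_assoc, pt_ps, comp_idl.
  - intros j; now rewrite comp_assoc, (ph_s (leg c j)).
  - now rewrite comp_assoc, Eh1, <- comp_assoc, pt_ps, comp_idr.
  - intros j; rewrite comp_assoc, Eh2; unfold w.
    now rewrite <- comp_assoc, Bs, pb_lift_snd. }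
assert (Ec : f ∘ pt_p B = pt_p (apex c) ∘ h) by now symmetry.
pose (k := pb_lift (P (apex c)) Ec).
assert (ks : k ∘ pt_s B = pt_s (base_obj H f (apex c))).
{ apply pb_hom_eq; unfold k; cbn; rewrite comp_assoc.
  - now rewrite !pb_lift_fst, pt_ps.
  - now rewrite !pb_lift_snd. }
exists ((@PointHom C X B (base_obj H f (apex c)) k (pb_lift_fst _ Ec) ks)
  : @hom (Pt X) B (base_obj H f (apex c))).
split.
- intros j; apply point_hom_eq, pb_hom_eq; cbn; unfold k;
    rewrite comp_assoc.
  + rewrite !pb_lift_fst; symmetry; exact (Bp j).
  + rewrite pb_lift_snd, <- comp_assoc, pb_lift_snd; exact (Eh2 j).
- intros k' Hk'; apply point_hom_eq, pb_hom_eq; cbn; unfold k.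
  + rewrite pb_lift_fst; symmetry; exact (ph_p k').
  + rewrite pb_lift_snd; apply Uh; split.
    * rewrite comp_assoc, <- pb_comm, <- comp_assoc; f_equal; exact (ph_p k').
    * intros j; unfold w, b; rewrite <- (Hk' j); cbn.
      now rewrite !comp_assoc, pb_lift_snd.
Qed.

(** Pasting of pullback squares. *)
Lemma change_of_base_comp (C : category) (H : has_split_pullbacks C)
  (X Y Z : C) (f : hom Y Z) (g : hom X Y) :
  nat_isomorphic (change_of_base H (f ∘ g))
    (functor_comp (change_of_base H g) (change_of_base H f)).
Proof.
assert (E1 : forall A : point Z,
  f ∘ (g ∘ pb_fst (the_pullback H (f ∘ g) A))
  = pt_p A ∘ pb_snd (the_pullback H (f ∘ g) A))
  by (intros A; now rewrite comp_assoc, pb_comm).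
assert (E2 : forall A : point Z,
  g ∘ pb_fst (the_pullback H (f ∘ g) A)
  = pt_p (base_obj H f A) ∘ pb_lift (the_pullback H f A) (E1 A))
  by (intros A; cbn; now rewrite pb_lift_fst).
assert (E3 : forall A : point Z,
  (f ∘ g) ∘ pb_fst (the_pullback H g (base_obj H f A))
  = pt_p A ∘ (pb_snd (the_pullback H f A)
              ∘ pb_snd (the_pullback H g (base_obj H f A)))).
{ intros A; rewrite <- comp_assoc, pb_comm; cbn.
  now rewrite !comp_assoc, pb_comm. }
pose (phi := fun A => pb_lift (the_pullback H g (base_obj H f A)) (E2 A)).
pose (psi := fun A => pb_lift (the_pullback H (f ∘ g) A) (E3 A)).
assert (phis : forall A,
  phi A ∘ pt_s (base_obj H (f ∘ g) A) = pt_s (base_obj H g (base_obj H f A))).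
{ intros A; unfold phi; apply pb_hom_eq; cbn; rewrite comp_assoc.
  - now rewrite !pb_lift_fst.
  - rewrite !pb_lift_snd; apply pb_hom_eq; rewrite !comp_assoc.
    + now rewrite !pb_lift_fst, <- comp_assoc, pb_lift_fst, comp_idl, comp_idr.
    + now rewrite !pb_lift_snd, comp_assoc. }
assert (psis : forall A,
  psi A ∘ pt_s (base_obj H g (base_obj H f A)) = pt_s (base_obj H (f ∘ g) A)).
{ intros A; unfold psi; apply pb_hom_eq; cbn; rewrite comp_assoc.
  - now rewrite !pb_lift_fst.
  - rewrite !pb_lift_snd, <- comp_assoc, pb_lift_snd; cbn.
    now rewrite comp_assoc, pb_lift_snd, comp_assoc. }
exists (fun A => (@PointHom C X (base_obj H (f ∘ g) A)
    (base_obj H g (base_obj H f A)) (phi A) (pb_lift_fst _ (E2 A)) (phis A))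
  : @hom (Pt X) (base_obj H (f ∘ g) A) (base_obj H g (base_obj H f A))).
exists (fun A => (@PointHom C X (base_obj H g (base_obj H f A))
    (base_obj H (f ∘ g) A) (psi A) (pb_lift_fst _ (E3 A)) (psis A))
  : @hom (Pt X) (base_obj H g (base_obj H f A)) (base_obj H (f ∘ g) A)).
split; [| split].
- intros A; apply point_hom_eq; unfold phi, psi; cbn.
  apply pb_hom_eq; rewrite comp_assoc, comp_idr.
  + now rewrite !pb_lift_fst.
  + now rewrite pb_lift_snd, <- comp_assoc, !pb_lift_snd.
- intros A; apply point_hom_eq; unfold phi, psi; cbn.
  apply pb_hom_eq; rewrite comp_assoc, comp_idr.
  + now rewrite !pb_lift_fst.
  + rewrite pb_lift_snd; apply pb_hom_eq; rewrite comp_assoc.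
    * rewrite pb_lift_fst, <- comp_assoc, pb_lift_fst.
      exact (pb_comm (the_pullback H g (base_obj H f A))).
    * now rewrite !pb_lift_snd.
- intros A B h; apply point_hom_eq; unfold phi, psi; cbn.
  apply pb_hom_eq; rewrite !comp_assoc.
  + now rewrite !pb_lift_fst.
  + rewrite !pb_lift_snd, <- comp_assoc, pb_lift_snd; cbn.
    apply pb_hom_eq; rewrite !comp_assoc.
    * now rewrite !pb_lift_fst, <- comp_assoc, pb_lift_fst.
    * now rewrite !pb_lift_snd, <- comp_assoc, pb_lift_snd.
Qed.

(** * Points over a zero object *)

Section ZeroObject.
Variables (C : category) (Z : C) (HZ : is_zero Z).

Definition forget_point : functor (Pt Z) C :=
  {| fobj := (@pt_obj C Z) : Pt Z -> C;
     fmap := fun A B h => @ph_hom C Z A B h;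
     fmap_id := fun _ => eq_refl;
     fmap_comp := fun _ _ _ _ _ => eq_refl |}.

Definition trivial_point_obj (A : C) : point Z :=
  {| pt_obj := A;
     pt_p := terminal_arrow (proj2 HZ) A;
     pt_s := initial_arrow (proj1 HZ) A;
     pt_ps := terminal_arrow_unique (proj2 HZ) _ _ |}.

(** Compatibility with projections and sections is automatic over a zero
    object. *)
Definition zero_point_hom (A B : point Z) (h : hom (pt_obj A) (pt_obj B))
  : @hom (Pt Z) A B :=
  {| ph_hom := h;
     ph_p := terminal_arrow_unique (proj2 HZ) _ _;
     ph_s := initial_arrow_unique (proj1 HZ) _ _ |}.

Lemma trivial_point_id (A : C) :
  @zero_point_hom (trivial_point_obj A) (trivial_point_obj A) (idm A)
  = idm (trivial_point_obj A : Pt Z).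
Proof. now apply point_hom_eq. Qed.

Lemma trivial_point_comp (A B D : C) (k : hom B D) (h : hom A B) :
  @zero_point_hom (trivial_point_obj A) (trivial_point_obj D) (k ∘ h)
  = @zero_point_hom (trivial_point_obj B) (trivial_point_obj D) k
    ∘ @zero_point_hom (trivial_point_obj A) (trivial_point_obj B) h.
Proof. now apply point_hom_eq. Qed.

Definition trivial_point : functor C (Pt Z) :=
  {| fobj := trivial_point_obj : C -> Pt Z;
     fmap := fun A B h =>
       @zero_point_hom (trivial_point_obj A) (trivial_point_obj B) h;
     fmap_id := trivial_point_id;
     fmap_comp := trivial_point_comp |}.

Lemma forget_point_coherent : coherent forget_point.
Proof.
apply equivalence_coherent.
- intros A B k; exists (zero_point_hom k); split; trivial.
  intros h E; apply point_hom_eq; now symmetry.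
- intros W; exists (trivial_point_obj W), (idm W), (idm W).
  split; apply comp_idl.
Qed.

Lemma trivial_point_coherent : coherent trivial_point.
Proof.
apply equivalence_coherent.
- intros A B k; exists (ph_hom k); split.
  + now apply point_hom_eq.
  + intros h E; now rewrite <- E.
- intros W; exists (pt_obj W).
  exists (@zero_point_hom (trivial_point_obj (pt_obj W)) W (idm (pt_obj W))).
  exists (@zero_point_hom W (trivial_point_obj (pt_obj W)) (idm (pt_obj W))).
  split; apply point_hom_eq; apply comp_idl.
Qed.

Variables (HL : has_finite_limits C) (H : has_split_pullbacks C).

(** The kernel of [p] is the pullback of [p] along the arrow from the zero
    object. *)
Lemma Ker_change_of_base (X : C) :
  nat_isomorphic (functor_comp forget_point
                    (change_of_base H (initial_arrow (proj1 HZ) X)))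
    (Ker HL HZ X).
Proof.
set (i := initial_arrow (proj1 HZ) X).
assert (E1 : forall A : point X,
  pt_p A ∘ pb_snd (the_pullback H i A)
  = zero_arrow HZ (pb_obj (the_pullback H i A)) X).
{ intros A; rewrite <- pb_comm; unfold zero_arrow, i; f_equal.
  apply (terminal_arrow_unique (proj2 HZ)). }
assert (E2 : forall A : point X,
  i ∘ terminal_arrow (proj2 HZ) (ker_obj (the_kernel HL HZ (pt_p A)))
  = pt_p A ∘ ker_hom (the_kernel HL HZ (pt_p A)))
  by (intros A; now rewrite ker_zero).
exists (fun A => ker_lift (the_kernel HL HZ (pt_p A)) (E1 A)).
exists (fun A => pb_lift (the_pullback H i A) (E2 A)).
split; [| split].
- intros A; apply pb_hom_eq.
  + apply (terminal_arrow_unique (proj2 HZ)).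
  + cbn; unfold Ker_obj.
    now rewrite comp_assoc, pb_lift_snd, ker_liftK, comp_idr.
- intros A; apply ker_hom_eq; cbn; unfold Ker_obj.
  now rewrite comp_assoc, ker_liftK, pb_lift_snd, comp_idr.
- intros A B h; apply ker_hom_eq; cbn; unfold Ker_hom, Ker_obj.
  rewrite !comp_assoc, !ker_liftK, pb_lift_snd.
  now rewrite <- comp_assoc, ker_liftK.
Qed.

Lemma change_of_base_Ker (X : C) :
  nat_isomorphic (functor_comp trivial_point (Ker HL HZ X))
    (change_of_base H (initial_arrow (proj1 HZ) X)).
Proof.
apply nat_isomorphic_sym.
destruct (Ker_change_of_base X) as (phi & psi & E1 & E2 & N).
exists (fun A => @zero_point_hom (base_obj H _ A)
  (trivial_point_obj (Ker HL HZ X A)) (phi A)).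
exists (fun A => @zero_point_hom (trivial_point_obj (Ker HL HZ X A))
  (base_obj H _ A) (psi A)).
split; [| split].
- intros A; apply point_hom_eq, E1.
- intros A; apply point_hom_eq, E2.
- intros A B h; apply point_hom_eq, N.
Qed.

Lemma Ker_coherent_iff (X : C) :
  coherent (change_of_base H (initial_arrow (proj1 HZ) X)) <->
  coherent (Ker HL HZ X).
Proof.
split; intros Hc.
- apply (coherent_iso (Ker_change_of_base X)).
  exact (coherent_comp forget_point_coherent Hc).
- apply (coherent_iso (change_of_base_Ker X)).
  exact (coherent_comp trivial_point_coherent Hc).
Qed.
End ZeroObject.

(** * Coherence of change of base along initial arrows *)

Lemma algebraically_coherent_initial (C : category) (HL : has_finite_limits C)
  (HP : protomodular C) (O : C) (HO : is_initial O) :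
  algebraically_coherent HL <->
  forall X : C,
    coherent (change_of_base (finite_limits_split_pullbacks HL)
                (initial_arrow HO X)).
Proof.
split; [intros HA X; apply HA |].
intros H X Y f; split; [now apply change_of_base_limits |].
destruct HP as [H' HR].
(* By proof irrelevance the chosen pullbacks do not depend on the witness. *)
rewrite (proof_irrelevance _ H' (finite_limits_split_pullbacks HL)) in HR.
apply (@preserves_jse_of_comp _ _ _
  (change_of_base (finite_limits_split_pullbacks HL) (initial_arrow HO X))).
- now apply change_of_base_limits.
- apply HR.
- apply (preserves_jse_iso (change_of_base_comp _ f (initial_arrow HO X))).
  rewrite (initial_arrow_unique HO (f ∘ initial_arrow HO X)
             (initial_arrow HO Y)).
  apply H.
Qed.

Theorem proposition3p12 (C : category) (HL : has_finite_limits C)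
    (HP : protomodular C) :
  (forall (O : C) (HO : is_initial O),
     algebraically_coherent HL <->
     forall X : C,
       coherent (change_of_base (finite_limits_split_pullbacks HL)
                   (initial_arrow HO X)))
  /\
  (forall (Z : C) (HZ : is_zero Z),
     algebraically_coherent HL <->
     forall X : C, coherent (Ker HL HZ X)).
Proof.
split; [intros O HO; now apply algebraically_coherent_initial |].
intros Z HZ.
rewrite (algebraically_coherent_initial HL HP (proj1 HZ)).
split; intros H X; now apply (Ker_coherent_iff HZ HL
  (finite_limits_split_pullbacks HL) X).
Qed.
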